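(* Let $p$ be a prime and $m\geq 3$ an integer with $\gcd(p,m)=1$ and $\gcd(p-1,m)=1$. Let $\ell=\min\{e\geq 1:\gcd(p^e-1,m)>1\}$, $L=\mathbb{F}_{p^\ell}$, $m'=\gcd(p^\ell-1,m)$, $H$ the group of $m'$th roots of unity in $L$, $T=\mathrm{tr}_{L/\mathbb{F}_p}(H)\subseteq\mathbb{F}_p$, and $t=|T|$. Let $n=\lceil \frac{p-1}{t-1}\rceil$. Then every integer $N\geq \ell n$ lies in $W_p(m')$, and $W_p(m')\subseteq W_p(m)$.
   Context: For a prime $p$ and a positive integer $m$, $W_p(m)$ denotes the set of integers $n\geq 0$ for which there exist $\alpha_1,\dots,\alpha_n\in\overline{\mathbb{F}}_p$ with $\alpha_i^m=1$ for all $i$ (repetitions allowed) and $\alpha_1+\cdots+\alpha_n=0$. Under the stated hypotheses one has $t\geq 2$, so $n$ is well defined. $\mathrm{tr}_{L/\mathbb{F}_p}$ is the field trace. *)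

(* Defs.v *)
From mathcomp Require Import all_boot all_order all_algebra all_fingroup all_field.

Set Implicit Arguments.
Unset Strict Implicit.
Unset Printing Implicit Defensive.

Import GRing.Theory.
Local Open Scope ring_scope.

(* The algebraic closure of 'F_p supplied by MathComp: an algebraically closed
   field, integral over the image of 'F_p. *)
Definition Fpbar (p : nat) : closedFieldType :=
  tag (countable_algebraic_closure 'F_p).

Definition W (p m : nat) (n : nat) : Prop :=
  exists alpha : 'I_n -> Fpbar p,
    (forall i, alpha i ^+ m = 1) /\ \sum_(i < n) alpha i = 0.

Definition is_min_exp (p m l : nat) : Prop :=
  [/\ (1 <= l)%N, (1 < gcdn (p ^ l - 1) m)%N
    & forall e : nat, (1 <= e)%N -> (1 < gcdn (p ^ e - 1) m)%N -> (l <= e)%N].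

(* [finvect_type L] is [L] itself, seen as a finite field and as a splitting
   (hence Galois) extension of 'F_p. *)
Definition unity_roots (p : nat) (L : fieldExtType 'F_p) (k : nat) :
    {set finvect_type L} :=
  [set h : finvect_type L | h ^+ k == 1].

(* [galTrace 1 {:L}] is the trace of L over its prime field, with values in the
   copy [1%VS] of 'F_p inside L; the image of A is pulled back to 'F_p along the
   injection c |-> c%:A. *)
Definition trace_image (p : nat) (L : fieldExtType 'F_p)
    (A : {set finvect_type L}) : {set 'F_p} :=
  [set c : 'F_p |
    c%:A \in [set galTrace 1%AS {:finvect_type L}%AS h | h in A]].

(* Main.v *)
(* By minimality of [l], a primitive [m']-th root of unity [x] generates [L].
   Hence the trace, being nonzero, does not vanish on all of [H], and since [H]
   sums to 0 it is not constant on [H] either: [t >= 2]. By Cauchy-Davenport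
   every element of 'F_p is a sum of [n] elements of [T]. The trace of [h] in [H]
   is the sum of its [l] Galois conjugates, again in [H], so every element of
   'F_p is a sum of [l * n] elements of [H]. Writing [- (N - l * n)] in this way
   and adding [N - l * n] copies of 1 gives a vanishing sum of length [N]. It is
   moved to the algebraic closure by sending [x] to a root of its minimal
   polynomial over 'F_p. *)
Require Import Defs.
From mathcomp Require Import all_boot all_order all_algebra all_fingroup all_solvable all_field.
Import Order.TTheory GRing.Theory Num.Theory.
Local Open Scope ring_scope.

(** * Sumsets in ['F_p] and the Cauchy-Davenport theorem *)

Definition sumset (V : finZmodType) (A B : {set V}) : {set V} :=
  [set a + b | a in A, b in B].

Lemma card_sumset_ge (V : finZmodType) (A B : {set V}) :
  B != set0 -> (#|A| <= #|sumset V A B|)%N.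
Proof.
case/set0Pn=> b Bb; rewrite -(card_imset (mem A) (addIr b)).
by apply/subset_leq_card/subsetP=> _ /imsetP[a Aa ->]; apply: imset2_f.
Qed.

(** A nonzero [d] generates the additive group of ['F_p]: from [a], any [x] is reached after as many
    steps as the natural number representing [(x - a) / d]. *)
Lemma translation_stable_setT (p : nat) (A : {set 'F_p}) (d : 'F_p) :
  d != 0 -> A != set0 -> (forall a, a \in A -> a + d \in A) -> A = setT.
Proof.
move=> d0 /set0Pn[a Aa] stA; apply/setP=> x; rewrite inE.
have st k : a + d *+ k \in A.
  by elim: k => [|k IHk]; rewrite ?addr0 // mulrSr addrA stA.
have -> : x = a + d *+ ((x - a) / d : 'F_p).
  by rewrite -mulr_natr natr_Zp mulrC divfK // addrC subrK.
exact: st.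
Qed.

(* Dyson's e-transform [A :|: (B + e)], [B :&: (A - e)] decreases [B] unless
   [A] is stable under the differences of [B]. *)
Lemma Cauchy_Davenport (p : nat) (p_prime : prime p) (A B : {set 'F_p}) :
  A != set0 -> B != set0 -> (minn p (#|A| + #|B|).-1 <= #|sumset _ A B|)%N.
Proof.
have [k] := ubnP #|B|; elim: k => // k IHk in A B *.
rewrite ltnS => Bk A0 B0.
have [/existsP[a /existsP[b /existsP[c /and4P[Aa Bb Bc nAc]]]]|stA] := boolP
    [exists a, exists b, exists c,
      [&& a \in A, b \in B, c \in B & c + (a - b) \notin A]].
  set e := a - b in nAc.
  pose B' := [set x in B | x + e \in A].
  pose A' := A :|: [set x + e | x in B].
  have sB' : B' \subset B by apply/subsetP=> x; rewrite inE => /andP[].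
  have ltB' : (#|B'| < #|B|)%N.
    apply/proper_card/properP; split=> //; exists c => //.
    by rewrite inE Bc.
  (* What [B] loses, [A] gains: the points of [B + e] outside [A] are exactly the translates by [e]
     of [B :\: B']. *)
  have cardA' : (#|A'| + #|B'| = #|A| + #|B|)%N.
    have -> : A' = A :|: [set x + e | x in B :\: B'].
      apply/setP=> x; rewrite !in_setU; have [//|nAx] := boolP (x \in A).
      apply/imsetP/imsetP => -[y By xE]; exists y => //.
        by rewrite !inE By -xE (negPf nAx).
      by case/setDP: By.
    rewrite cardsU disjoint_setI0 ?cards0 ?subn0; last first.
      rewrite disjoint_sym disjoints_subset; apply/subsetP=> _ /imsetP[y By ->].
      by move: By; rewrite !inE => /andP[+ By]; rewrite By.
    rewrite (card_imset _ (addIr e)) cardsD (setIidPr sB') -addnA subnK //.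
    exact: subset_leq_card.
  have A'0 : A' != set0 by apply/set0Pn; exists a; rewrite in_setU Aa.
  have B'0 : B' != set0.
    by apply/set0Pn; exists b; rewrite inE Bb /e addrC subrK.
  rewrite -cardA'; apply: leq_trans (IHk A' B' (leq_trans ltB' Bk) A'0 B'0) _.
  apply/subset_leq_card/subsetP=> _ /imset2P[x y + + ->].
  rewrite in_setU [y \in _]inE => /orP[Ax|/imsetP[z Bz ->]] /andP[By Aye].
    exact: imset2_f.
  (* The shift [e] moves from one summand to the other: [(z + e) + y = (y + e) + z], where [y + e]
     is in [A] because [y] is in [B']. *)
  by rewrite -addrA addrC [e + y]addrC; apply: imset2_f.
have [/eqP/cards1P[b ->]|B1] := eqVneq #|B| 1%N.
  rewrite cards1 addn1 geq_min card_sumset_ge ?orbT //.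
  by apply/set0Pn; exists b; rewrite inE.
have /card_gt1P[b [c [Bb Bc bc]]] : (1 < #|B|)%N.
  by rewrite ltn_neqAle eq_sym B1 card_gt0.
(* No transform shrinks [B] here, so two distinct elements [b], [c] of [B] give a nonzero
   translation [c - b] preserving [A]. *)
suff AT : A = setT.
  by rewrite geq_min (leq_trans _ (card_sumset_ge _ A B B0)) // AT cardsT card_Fp.
apply: (translation_stable_setT _ _ (c - b)) => // [|a Aa].
  by rewrite subr_eq0 eq_sym.
apply: contraNT stA => nA; apply/existsP; exists a; apply/existsP; exists b.
by apply/existsP; exists c; rewrite Aa Bb Bc addrCA.
Qed.

(** By Cauchy-Davenport, each further copy of [A] enlarges the sumset by at least [#|A|.-1] elements
    until all [p] are reached. *)
Lemma iterated_sumset_full (p k : nat) (p_prime : prime p) (A : {set 'F_p}) :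
  A != set0 -> (p <= (k * #|A|.-1).+1)%N ->
  forall c, exists s : seq 'F_p, [/\ size s = k, all (mem A) s & \sum_(x <- s) x = c].
Proof.
move=> A0 pk c; pose S j := iter j (sumset _ A) [set 0].
have A1 : (0 < #|A|)%N by rewrite card_gt0.
have cardS j : (minn p (j * #|A|.-1).+1 <= #|S j|)%N.
  elim: j => [|j IHj]; first by rewrite cards1 mul0n geq_minr.
  have Sj0 : S j != set0.
    by rewrite -card_gt0 (leq_trans _ IHj) // leq_min prime_gt0.
  apply: leq_trans (Cauchy_Davenport _ p_prime A (S j) A0 Sj0).
  rewrite leq_min geq_minl /= geq_min -[#|A|]prednK // addSn /= mulSn -addnS.
  case: (leqP p (j * #|A|.-1).+1) IHj => _ IHj; last by rewrite leq_add2l IHj orbT.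
  by rewrite (leq_trans IHj) ?leq_addl.
suff /setP/(_ c) : S k = setT.
  rewrite inE /S; elim: k {pk} c => [|k IHk] c /=.
    by rewrite inE => /eqP->; exists [::]; rewrite big_nil.
  case/imset2P=> a y Aa /IHk[s [<- As <-]] ->; exists (a :: s).
  by rewrite /= Aa As big_cons.
apply/eqP; rewrite eqEcard subsetT cardsT card_Fp //.
by apply: leq_trans (cardS k); rewrite leq_min leqnn.
Qed.

(** * Finite fields and the passage to the algebraic closure *)

Lemma card_finvect (F : finFieldType) (V : vectType F) :
  #|finvect_type V| = (#|F| ^ \dim {:finvect_type V})%N.
Proof.
rewrite -(@card_vspace _ (finvect_type V) (Vector.class (finvect_type V))).
by apply: eq_card => v; rewrite memvf.
Qed.

(** The nonzero elements are [#|F|.-1] distinct roots of unity of that order, so one of them is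
    primitive; a suitable power of it has order [m]. *)
Lemma finField_prim_root (F : finFieldType) (m : nat) :
  (m %| #|F|.-1)%N -> exists x : F, m.-primitive_root x.
Proof.
move=> dvm.
have F0 : (0 < #|F|)%N by apply: ltnW (finNzRing_gt1 F).
have F1 : (0 < #|F|.-1)%N by rewrite -ltnS prednK ?finNzRing_gt1.
have /hasP[g _ gP] : has (#|F|.-1).-primitive_root (enum (predC1 (0 : F))).
  apply: has_prim_root => //; last by rewrite -cardE cardC1.
    apply/allP=> x; rewrite mem_enum inE unity_rootE => x0.
    by rewrite -(inj_eq (mulfI x0)) mulr1 -exprS prednK ?expf_card.
  exact: enum_uniq.
by exists (g ^+ (#|F|.-1 %/ m)); apply: dvdn_prim_root.
Qed.

Definition Fpbar_morph p : {rmorphism 'F_p -> Fpbar p} :=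
  sval (tagged (countable_algebraic_closure 'F_p)).

(** The minimal polynomial of [x] divides every [q] vanishing at [x], so any of its roots [z] in the
    closure inherits all polynomial relations of [x] over ['F_p]. *)
Lemma Fpbar_conjugate (p : nat) (L : fieldExtType 'F_p) (x : L) :
  exists z : Fpbar p, forall q : {poly 'F_p},
    root (map_poly (in_alg L) q) x -> root (map_poly (Fpbar_morph p) q) z.
Proof.
have /polyOver1P[r rE] := minPolyOver 1%AS x.
have /closed_rootP[z rz] : size (map_poly (Fpbar_morph p) r) != 1%N.
  by rewrite size_map_poly -(size_map_poly (in_alg L)) -rE size_minPoly.
exists z => q qx; have : minPoly 1%AS x %| map_poly (in_alg L) q.
  by apply: minPoly_dvdp qx; apply: alg_polyOver.
by rewrite rE dvdp_map -(dvdp_map (Fpbar_morph p)) => /dvdpP[u ->]; rewrite rootM rz orbT.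
Qed.

Lemma horner_map_sumXn (A R : nzRingType) (f : {rmorphism A -> R}) (I : finType)
    (k : I -> nat) (u : R) :
  (map_poly f (\sum_i 'X^(k i))).[u] = \sum_i u ^+ k i.
Proof.
rewrite raddf_sum horner_sum; apply: eq_bigr => i _.
by rewrite /= map_polyXn hornerXn.
Qed.

(** Every term of [s] is a power of [x], so the hypotheses become two polynomial relations on [x],
    which pass to its conjugate [z]. *)
Lemma W_of_vanishing_sum (p m : nat) (L : fieldExtType 'F_p) (x : L) (s : seq L) :
  m.-primitive_root x -> all (fun a => a ^+ m == 1) s -> \sum_(a <- s) a = 0 ->
  W p m (size s).
Proof.
move=> xP /allP sm s0; have [z zP] := Fpbar_conjugate _ _ x.
have /fin_all_exists[k kE] (i : 'I_(size s)) : exists k : nat, s`_i = x ^+ k.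
  have /prim_rootP -/(_ _ xP)[k ->] : s`_i ^+ m = 1; last by exists k.
  by apply/eqP/sm/mem_nth.
have zm : z ^+ m = 1.
  have := zP ('X^m - 1); rewrite !rmorphB !rmorph1 /= !map_polyXn !rootE !hornerE.
  by rewrite (prim_expr_order xP) subrr eqxx subr_eq0 => /(_ isT)/eqP.
exists (fun i => z ^+ k i); split=> [i|]; first by rewrite exprAC zm expr1n.
have := zP (\sum_i 'X^(k i)); rewrite !rootE !horner_map_sumXn.
rewrite -(eq_bigr _ (fun i _ => kE i)) -(big_mkord xpredT (nth 0 s)).
by rewrite -(big_nth 0 xpredT id) s0 eqxx => /(_ isT)/eqP.
Qed.

(** * Traces of roots of unity *)

Section Trace.
Variables (p : nat) (L : fieldExtType 'F_p).
Local Notation F := (finvect_type L).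
Local Notation tr := (galTrace 1%AS {:F}%AS).

Lemma galTraceZ (c : 'F_p) (a : F) : tr (c *: a) = c *: tr a.
Proof. by rewrite scaler_sumr; apply: eq_bigr => g _; rewrite linearZ. Qed.

(** Dedekind independence of the automorphisms, applied with all coefficients equal to 1. *)
Lemma galTrace_neq0 : exists a : F, tr a != 0.
Proof.
have [a _ tra] := gal_independent_contra (group1 'Gal({:F} / 1))
  (oner_neq0 F : (fun=> 1) 1%g != 0).
by exists a; rewrite /galTrace; under eq_bigr do rewrite -[_ a]mul1r.
Qed.

Lemma mem_trace_image (A : {set F}) (h : F) :
  h \in A -> exists2 c, c \in trace_image A & tr h = c%:A.
Proof.
move=> Ah; have /vlineP[c hc] : tr h \in 1%VS.
  by apply: mem_galTrace (memvf h); apply: finField_galois; apply: sub1v.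
by exists c => //; rewrite inE -hc imset_f.
Qed.

Lemma trace_image_sum (k : nat) (c : 'F_p) :
  c \in trace_image (unity_roots L k) ->
  exists s : seq F, [/\ size s = \dim {:F}%VS, all (fun a => a ^+ k == 1) s
    & \sum_(a <- s) a = c%:A].
Proof.
rewrite inE => /imsetP[h]; rewrite inE => /eqP hk ->.
exists [seq (g : gal_of {:F}) h | g <- enum 'Gal({:F} / 1)%g]; split.
- rewrite size_map -cardE -galois_dim ?dimv1 ?divn1 //.
  exact: finField_galois (sub1v _).
- by apply/allP=> _ /mapP[g _ ->]; rewrite -rmorphXn hk rmorph1.
- by rewrite big_map big_enum.
Qed.

Lemma trace_image_sums (k : nat) (u : seq 'F_p) :
  all (mem (trace_image (unity_roots L k))) u ->
  exists s : seq F, [/\ size s = (size u * \dim {:F}%VS)%N,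
    all (fun a => a ^+ k == 1) s & \sum_(a <- s) a = (\sum_(c <- u) c)%:A].
Proof.
elim: u => [|c u IHu] /=; first by exists [::]; rewrite !big_nil scale0r.
case/andP=> /trace_image_sum[s [sz_s sk s_c]] /IHu[v [sz_v vk v_u]].
exists (s ++ v); rewrite size_cat all_cat sk vk sz_s sz_v; split=> //.
by rewrite !big_cat big_cons s_c v_u scalerDl.
Qed.

(* If all the traces were equal, they would vanish because the roots of unity
   sum to 0, and so would the trace of [L], which [x] generates. *)
Lemma trace_image_gt1 (k : nat) (x : F) :
  (1 < k)%N -> k.-primitive_root x -> <<1; x>>%VS = {:F}%VS ->
  (1 < #|trace_image (unity_roots L k)|)%N.
Proof.
move=> k1 xP Fx; rewrite ltnNge; apply/negP=> /card_le1_eqP T1.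
have memH i : x ^+ i \in unity_roots L k.
  by rewrite inE exprAC (prim_expr_order xP) expr1n.
have trH i : tr (x ^+ i) = tr 1.
  have [c cT ->] := mem_trace_image _ _ (memH i).
  have [d dT] := mem_trace_image _ _ (memH 0); rewrite expr0 => ->.
  by rewrite (T1 _ _ cT dT).
have sum0 : \sum_(i < k) x ^+ i = 0.
  have x1 : x - 1 != 0.
    by rewrite subr_eq0 -[x]expr1 -(prim_order_dvd xP) dvdn1 gtn_eqF.
  by apply: (mulfI x1); rewrite mulr0 -subrX1 (prim_expr_order xP) subrr.
(* Taking traces in [sum0] gives [k] times [tr 1] equal to 0, and [k] is nonzero in the field
   because a primitive [k]-th root of unity exists there. *)
have tr1 : tr 1 = 0.
  have := congr1 tr sum0; rewrite raddf0 raddf_sum.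
  rewrite (eq_bigr (fun=> tr 1)) => [|i _]; last exact: trH.
  rewrite sumr_const card_ord -mulr_natr => /eqP.
  by rewrite mulf_eq0 (negPf (prim_root_natf_neq0 xP)) orbF => /eqP.
have [a] := galTrace_neq0; have := memvf a; rewrite -Fx => /Fadjoin1_polyP[q ->].
rewrite horner_coef raddf_sum big1 ?eqxx // => i _.
by rewrite coef_map /= -scalerAl mul1r galTraceZ trH tr1 scaler0.
Qed.

End Trace.

(** * Minimality of [l] and the final count *)

(** If [x] generates a subfield of degree [d], Fermat's theorem there makes [k] divide [p ^ d - 1],
    so the minimality of [l] forces [l <= d]. *)
Lemma adjoin_prim_root_full (p m l : nat) (F : fieldExtType 'F_p) (x : F)
    (k : nat) (p_prime : prime p) :
  is_min_exp p m l -> (k %| m)%N -> (1 < k)%N -> (0 < m)%N ->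
  \dim {:F}%VS = l -> k.-primitive_root x -> <<1; x>>%VS = {:F}%VS.
Proof.
move=> [l1 _ l_min] km k1 m0 dimF xP; apply/eqP; rewrite eqEdim subvf dimF /=.
set d := \dim _; have d1 : (0 < d)%N by apply: adim_gt0.
apply: l_min => //; apply: leq_trans k1 _; apply: dvdn_leq.
  by rewrite gcdn_gt0 m0 orbT.
rewrite dvdn_gcd km andbT (prim_order_dvd xP).
have x0 : x != 0 by rewrite (prim_root_eq0 xP) -lt0n (prim_order_gt0 xP).
rewrite -(inj_eq (mulfI x0)) mulr1 -exprS subn1 prednK ?expn_gt0 ?prime_gt0 //.
by have := memv_adjoin 1 x; rewrite (Fermat's_little_theorem <<1; x>>) card_Fp.
Qed.

Lemma W_dvd (p k m N : nat) : (k %| m)%N -> W p k N -> W p m N.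
Proof.
case/dvdnP=> d -> [alpha [alpha1 alpha0]]; exists alpha; split=> // i.
by rewrite mulnC exprM alpha1 expr1n.
Qed.

(** The quotient is nonnegative, so its integer ceiling is a natural number, which serves as [k]. *)
Lemma ceil_div_le (a b N l : nat) : (0 < b)%N ->
  l%:Z * Num.ceil (a%:R / b%:R : rat) <= N%:Z ->
  exists2 k : nat, (a <= k * b)%N & (l * k <= N)%N.
Proof.
move=> b0; set x : rat := _ / _ => lN.
have x0 : 0 <= x by rewrite divr_ge0 ?ler0n.
have : 0 <= Num.ceil x by rewrite ceil_ge0 (lt_le_trans _ x0).
have := ceil_ge x; case: (Num.ceil x) lN => // k lN xk _.
exists k; last by rewrite -lez_nat PoszM.
by rewrite -(ler_nat rat) natrM -ler_pdivrMr ?ltr0n.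
Qed.

Theorem theorem5p3 (p m l : nat) (L : fieldExtType 'F_p)
    (p_prime : prime p) (m_ge3 : (3 <= m)%N)
    (co_p_m : gcdn p m = 1%N) (co_p1_m : gcdn (p - 1) m = 1%N)
    (l_min : is_min_exp p m l)
    (L_card : #|finvect_type L| = (p ^ l)%N) :
  let m' := gcdn (p ^ l - 1) m in
  let H := unity_roots L m' in
  let T := trace_image H in
  let t := #|T| in
  let n : int := Num.ceil ((p%:R - 1) / (t%:R - 1) : rat) in
  (forall N : nat, l%:Z * n <= N%:Z -> W p m' N) /\
  (forall N : nat, W p m' N -> W p m N).
Proof.
move=> m' H T t n.
have m0 : (0 < m)%N by apply: leq_trans m_ge3.
have m'm : (m' %| m)%N by apply: dvdn_gcdr.
split; last by move=> N; apply: W_dvd.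
have m'1 : (1 < m')%N by case: l_min.
have [x xP] : exists x : finvect_type L, m'.-primitive_root x.
  by apply: finField_prim_root; rewrite L_card -subn1 dvdn_gcdl.
have dimL : \dim {:finvect_type L}%VS = l.
  apply: (@expnI p); first exact: prime_gt1.
  by rewrite -L_card card_finvect card_Fp.
have Lx := adjoin_prim_root_full _ _ _ _ _ _ p_prime l_min m'm m'1 m0 dimL xP.
have t1 : (1 < t)%N := trace_image_gt1 _ _ _ _ m'1 xP Lx.
(* Since [p] and [t] are positive, the rational differences are casts of natural ones, as
   [ceil_div_le] expects. *)
move=> N; rewrite /n -[1%R : rat]/(1%:R) -!natrB ?(prime_gt0 p_prime) ?(ltnW t1) // => lnN.
have t_gt0 : (0 < t - 1)%N by rewrite subn_gt0.
have [k pk lkN] := ceil_div_le _ _ _ _ t_gt0 lnN.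
have T0 : T != set0 by rewrite -card_gt0 ltnW.
have pkT : (p <= (k * #|T|.-1).+1)%N by rewrite -add1n -leq_subLR -[#|T|.-1]subn1.
have [u [sz_u uT u_sum]] := iterated_sumset_full p k p_prime T T0 pkT (- (N - l * k)%:R).
have [s [sz_s sk s_sum]] := trace_image_sums _ _ _ _ uT.
have -> : N = size (s ++ nseq (N - l * k) 1).
  by rewrite size_cat size_nseq sz_s sz_u dimL mulnC subnKC.
apply: (W_of_vanishing_sum _ _ _ x) => //.
  by rewrite all_cat sk all_nseq expr1n eqxx orbT.
by rewrite big_cat /= s_sum u_sum big_nseq iter_addr_0 scaleNr scaler_nat addNr.
Qed.
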